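(* The logic $\mathsf{C2.F}$ is weakly complete with respect to finite flat order frames: for every $p\in\mathcal{L}_>$, if $p$ is true at every world of every order model based on a finite flat order frame, then $\vdash_{\mathsf{C2.F}}p$.
   Context: Language. Let $At=\{p_0,p_1,\ldots\}$ be a countably infinite set of atoms. $\mathcal{L}_>$ is generated by $p ::= p_k\in At\mid \neg p\mid (p\wedge p)\mid (p>p)$; $\vee,\to,\leftrightarrow$ are defined as usual. Logics. $\mathsf{C2}$ is the smallest set of $\mathcal{L}_>$-sentences containing all instances of: (PC) every (substitution instance of a) theorem of classical propositional logic; (Identity) $p>p$; (Reciprocity) $(p>q)\wedge(q>p)\wedge(p>r)\to(q>r)$; (MP) $(p>q)\to(p\to q)$; (CEM) $(p>q)\vee(p>\neg q)$; and closed under (Detachment) from $\vdash p\to q$ and $\vdash p$ infer $\vdash q$; (Normality) from $\vdash(p\wedge q)\to r$ infer $\vdash((s>p)\wedge(s>q))\to(s>r)$. $\mathsf{C2.F}$ is the smallest extension of $\mathsf{C2}$ containing every instance of (Flattening) $(p>((p\wedge q)>r))\leftrightarrow((p\wedge q)>r)$ and closed under Detachment and Normality. $\vdash_{\mathsf{C2.F}}p$ means $p\in\mathsf{C2.F}$. Order frames and models. An order frame is a pair $\langle W,<\rangle$ where $W\neq\varnothing$ and $<$ is a function taking each $w\in W$ to a strict well-order $<_w$ on some subset of $W$ such that whenever $x<_w y$, either $w=x$ or $w<_w x$. Its accessibility relation is $R(w)=\{w\}\cup\{v: w<_w v\}$. An order model $\langle W,<,V\rangle$ adds a valuation $V:At\times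 W\to\{0,1\}$; put $V(p_k)=\{w:V(p_k,w)=1\}$. Denotations: $[\![p_k]\!]=V(p_k)$, $[\![\neg p]\!]=W\setminus[\![p]\!]$, $[\![p\wedge q]\!]=[\![p]\!]\cap[\![q]\!]$, and $w\in[\![p>q]\!]$ iff either $R(w)\cap[\![p]\!]=\varnothing$, or there is $y\in R(w)\cap[\![p]\!]\cap[\![q]\!]$ such that $x\notin[\![p]\!]$ whenever $x<_w y$. A sentence $p$ is true at $w$ iff $w\in[\![p]\!]$. A frame is finite iff $W$ is finite. An order frame is semi-flat iff whenever $x<_w y$, we have $y\in R(x)$ and, for all $z$ such that $y<_w z$ or $z\in R(x)\setminus R(w)$, $y<_x z$. It is flat iff it is semi-flat and $R$ is transitive. *)

(* Defs.v *)
From Stdlib Require Import RelationClasses FinFun.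

Inductive sentence : Type :=
| Atom (k : nat)
| Neg (p : sentence)
| And (p q : sentence)
| Cond (p q : sentence).

Definition Or (p q : sentence) : sentence := Neg (And (Neg p) (Neg q)).
Definition Imp (p q : sentence) : sentence := Neg (And p (Neg q)).
Definition Iff (p q : sentence) : sentence := And (Imp p q) (Imp q p).

Inductive pform : Type :=
| PVar (k : nat)
| PNeg (a : pform)
| PAnd (a b : pform).

Fixpoint peval (v : nat -> bool) (a : pform) : bool :=
  match a with
  | PVar k => v k
  | PNeg a => negb (peval v a)
  | PAnd a b => andb (peval v a) (peval v b)
  end.

Definition tautology (a : pform) : Prop := forall v, peval v a = true.

Fixpoint psubst (s : nat -> sentence) (a : pform) : sentence :=
  match a with
  | PVar k => s k
  | PNeg a => Neg (psubst s a)
  | PAnd a b => And (psubst s a) (psubst s b)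
  end.

Inductive C2 : sentence -> Prop :=
| C2_PC a s : tautology a -> C2 (psubst s a)
| C2_Identity p : C2 (Cond p p)
| C2_Reciprocity p q r :
    C2 (Imp (And (And (Cond p q) (Cond q p)) (Cond p r)) (Cond q r))
| C2_MP p q : C2 (Imp (Cond p q) (Imp p q))
| C2_CEM p q : C2 (Or (Cond p q) (Cond p (Neg q)))
| C2_Detachment p q : C2 (Imp p q) -> C2 p -> C2 q
| C2_Normality p q r s :
    C2 (Imp (And p q) r) -> C2 (Imp (And (Cond s p) (Cond s q)) (Cond s r)).

Inductive C2F : sentence -> Prop :=
| C2F_C2 p : C2 p -> C2F p
| C2F_Flattening p q r :
    C2F (Iff (Cond p (Cond (And p q) r)) (Cond (And p q) r))
| C2F_Detachment p q : C2F (Imp p q) -> C2F p -> C2F q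
| C2F_Normality p q r s :
    C2F (Imp (And p q) r) -> C2F (Imp (And (Cond s p) (Cond s q)) (Cond s r)).

Record strict_well_order_on {A : Type} (S : A -> Prop) (lt : A -> A -> Prop) :
    Prop := {
  swo_field : forall x y, lt x y -> S x /\ S y;
  swo_strict : StrictOrder lt;
  swo_total : forall x y, S x -> S y -> lt x y \/ x = y \/ lt y x;
  swo_least : forall P : A -> Prop,
    (forall x, P x -> S x) -> (exists x, P x) ->
    exists m, P m /\ forall x, P x -> x = m \/ lt m x
}.

(** [prec w x y] is [x <_w y]. *)
Record order_frame : Type := {
  world :> Type;
  world_nonempty : inhabited world;
  prec : world -> world -> world -> Prop;
  prec_well_order :
    forall w, exists S : world -> Prop, strict_well_order_on S (prec w);
  prec_centered : forall w x y, prec w x y -> w = x \/ prec w w x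
}.

Arguments prec {_} _ _ _.

(** [access w v] is [v \in R(w)]. *)
Definition access {F : order_frame} (w v : F) : Prop := v = w \/ prec w w v.

Record order_model : Type := {
  frame :> order_frame;
  val : nat -> frame -> bool
}.

Fixpoint true_at (M : order_model) (p : sentence) (w : M) : Prop :=
  match p with
  | Atom k => val M k w = true
  | Neg p => ~ true_at M p w
  | And p q => true_at M p w /\ true_at M q w
  | Cond p q =>
      (forall y, access w y -> ~ true_at M p y) \/
      (exists y, access w y /\ true_at M p y /\ true_at M q y /\
                 forall x, prec w x y -> ~ true_at M p x)
  end.

Definition finite_frame (F : order_frame) : Prop := Finite F.

Definition semi_flat (F : order_frame) : Prop :=
  forall w x y : F, prec w x y ->
    access x y /\
    forall z, prec w y z \/ (access x z /\ ~ access w z) -> prec x y z.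

Definition flat (F : order_frame) : Prop :=
  semi_flat F /\ Transitive (@access F).

(* Main.v *)
(** A point is a Boolean valuation of all sentences that makes the theorems
    true, and [p > q] holds at [u] iff [q] holds at the point
    [select p u = {q | u (p > q)}].  Flattening says exactly that if [p] entails
    [q], selecting [p] can be done by first selecting [q].  Passing to state
    descriptions over the subformulas of the target sentence, each point "sees"
    finitely many descriptions in a definite order, and these orders cohere as
    in a flat frame, except that there are infinitely many points.

    To cut down to a finite frame, build ordinal words from single points by
    concatenation and omega-repetition: their positions, each looking at the
    first later occurrences of all positions, form finite flat frames.  Nested
    repetitions cannot be avoided: a point may see [b], then [c], while [b] sees
    [a], then [c], and [a] sees [b], then [c].  By induction on the number of
    descriptions seen by [u] before a set [Z], there is such a word that starts
    like [u] and leads to the first [Z]-point of [u]: if [e] is the last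
    description before [Z], take a word leading from [u] to its [e]-point, and
    go on from there until fewer descriptions are seen before [Z], or until a
    behaviour recurs, in which case the word is repeated forever. *)

From HB Require Import structures.
From mathcomp Require Import all_boot.
From mathcomp Require Import boolp.
Require Import Defs.

Set Implicit Arguments.
Unset Strict Implicit.
Unset Printing Implicit Defensive.

(** * Maximal consistent sets of C2.F as points *)

Definition valuation_of_logic (u : sentence -> bool) : Prop :=
  [/\ forall p, C2F p -> u p,
      forall p, u (Neg p) = ~~ u p &
      forall p q, u (And p q) = u p && u q].

(** The condition is a boolean, so that a point is determined by its valuation and [insub] can test
    whether a valuation is a point. *)
Record point := Point {
  holds :> sentence -> bool;
  holdsP : `[< valuation_of_logic holds >]
}.
HB.instance Definition _ := [isSub for holds].

Section Points.
Implicit Types (u v : point) (p q r : sentence).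

Lemma holds_thm u p : C2F p -> u p.
Proof. by move/asboolP: (holdsP u) => [h _ _] /h. Qed.

Lemma holdsN u p : u (Neg p) = ~~ u p.
Proof. by move/asboolP: (holdsP u) => [_ h _]. Qed.

Lemma holdsA u p q : u (And p q) = u p && u q.
Proof. by move/asboolP: (holdsP u) => [_ _ h]. Qed.

Lemma holdsI u p q : u (Imp p q) = (u p ==> u q).
Proof. by rewrite /Imp !(holdsN, holdsA) negb_and negbK implybE. Qed.

Lemma holdsO u p q : u (Or p q) = u p || u q.
Proof. by rewrite /Or !(holdsN, holdsA) negb_and !negbK. Qed.

Lemma holdsE u p q : u (Iff p q) = (u p == u q).
Proof. by rewrite /Iff holdsA !holdsI; case: (u p); case: (u q). Qed.

Lemma C2F_PC a s : tautology a -> C2F (psubst s a).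
Proof. by move=> h; apply: C2F_C2; apply: C2_PC. Qed.

Definition pimp a b := PNeg (PAnd a (PNeg b)).

Lemma C2F_K p q : C2F (Imp p (Imp q p)).
Proof.
apply: (@C2F_PC (pimp (PVar 0) (pimp (PVar 1) (PVar 0))) (nth p [:: p; q])).
by move=> v /=; case: (v 0); case: (v 1).
Qed.

Lemma C2F_S p q r : C2F (Imp (Imp p (Imp q r)) (Imp (Imp p q) (Imp p r))).
Proof.
apply: (@C2F_PC (pimp (pimp (PVar 0) (pimp (PVar 1) (PVar 2)))
  (pimp (pimp (PVar 0) (PVar 1)) (pimp (PVar 0) (PVar 2)))) (nth p [:: p; q; r])).
by move=> v /=; case: (v 0); case: (v 1); case: (v 2).
Qed.

Lemma C2F_cases p q : C2F (Imp (Imp p q) (Imp (Imp (Neg p) q) q)).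
Proof.
apply: (@C2F_PC (pimp (pimp (PVar 0) (PVar 1))
  (pimp (pimp (PNeg (PVar 0)) (PVar 1)) (PVar 1))) (nth p [:: p; q])).
by move=> v /=; case: (v 0); case: (v 1).
Qed.

Lemma C2F_explosion p q : C2F (Imp p (Imp (Neg p) q)).
Proof.
apply: (@C2F_PC (pimp (PVar 0) (pimp (PNeg (PVar 0)) (PVar 1))) (nth p [:: p; q])).
by move=> v /=; case: (v 0); case: (v 1).
Qed.

Lemma C2F_andI p q : C2F (Imp p (Imp q (And p q))).
Proof.
apply: (@C2F_PC (pimp (PVar 0) (pimp (PVar 1) (PAnd (PVar 0) (PVar 1))))
  (nth p [:: p; q])).
by move=> v /=; case: (v 0); case: (v 1).
Qed.

Lemma C2F_andEl p q : C2F (Imp (And p q) p).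
Proof.
apply: (@C2F_PC (pimp (PAnd (PVar 0) (PVar 1)) (PVar 0)) (nth p [:: p; q])).
by move=> v /=; case: (v 0); case: (v 1).
Qed.

Lemma C2F_andEr p q : C2F (Imp (And p q) q).
Proof.
apply: (@C2F_PC (pimp (PAnd (PVar 0) (PVar 1)) (PVar 1)) (nth p [:: p; q])).
by move=> v /=; case: (v 0); case: (v 1).
Qed.

Lemma C2F_refl p : C2F (Imp p p).
Proof.
apply: (@C2F_PC (pimp (PVar 0) (PVar 0)) (fun=> p)).
by move=> v /=; case: (v 0).
Qed.

(** The numbering orders the Lindenbaum construction; its injectivity later also gives sentences a
    decidable equality. *)
Fixpoint code p : nat :=
  match p with
  | Atom k => pickle (0, k)
  | Neg p => pickle (1, code p)
  | And p q => pickle (2, pickle (code p, code q))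
  | Cond p q => pickle (3, pickle (code p, code q))
  end.

Lemma code_inj : injective code.
Proof.
have pk (a b c d : nat) : pickle (a, b) = pickle (c, d) -> a = c /\ b = d.
  by move=> /(pcan_inj pickleK) [-> ->].
elim=> [k|p IHp|p IHp q IHq|p IHp q IHq] [k'|p'|p' q'|p' q'] /= /pk [] //.
- by move=> _ ->.
- by move=> _ /IHp ->.
- by move=> _ /pk [/IHp -> /IHq ->].
- by move=> _ /pk [/IHp -> /IHq ->].
Qed.

Definition theory (Th : sentence -> Prop) : Prop :=
  (forall p, C2F p -> Th p) /\ (forall p q, Th (Imp p q) -> Th p -> Th q).

Lemma theory_extend Th p : theory Th -> theory (fun q => Th (Imp p q)).
Proof.
move=> [thm det]; split=> [q Cq|q r hqr hq].
  exact: det (thm _ (C2F_K _ _)) (thm _ Cq).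
exact: det (det _ _ (thm _ (C2F_S _ _ _)) hqr) hq.
Qed.

(** Lindenbaum's construction avoiding [f]. A premise [p] is added by passing to the [q] with
    [Imp p q] in the theory, which avoids defining derivability from premises. *)
Fixpoint stage (f : sentence) (n : nat) : sentence -> Prop :=
  if n is m.+1 then
    fun q => stage f m q \/
      exists p, [/\ code p = m, ~ stage f m (Imp p f) & stage f m (Imp p q)]
  else C2F.

Lemma stage_theory f n : theory (stage f n).
Proof.
elim: n => [|n IHn]; first by split=> // p q; apply: C2F_Detachment.
have [thm det] := IHn.
have [[p [pn hp]]|nop] :=
  pselect (exists p, code p = n /\ ~ stage f n (Imp p f)).
- have -> : stage f n.+1 = fun q => stage f n (Imp p q); last exact: theory_extend.
  apply/funext=> q; apply/propext; split=> [[hq|[p' [p'n _ hq]]]|hq].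
  + exact: det (thm _ (C2F_K _ _)) hq.
  + by rewrite -p'n in pn; rewrite (code_inj pn).
  + by right; exists p.
- have -> : stage f n.+1 = stage f n; last exact: IHn.
  apply/funext=> q; apply/propext; split=> [[//|[p [pn hp _]]]|]; last by left.
  by case: nop; exists p.
Qed.

Lemma stage_consistent f n : ~ C2F f -> ~ stage f n f.
Proof. by move=> hf; elim: n => //= n IHn [//|[p [_ hp]]]. Qed.

Lemma stage_mono f m n p : m <= n -> stage f m p -> stage f n p.
Proof.
move=> /subnK <-; elim: (n - m) => // k IHk h.
by rewrite addSn /=; left; apply: IHk.
Qed.

Lemma lindenbaum f : (forall u, u f) -> C2F f.
Proof.
move=> all_f; apply: contrapT => nf.
pose Th q := exists n, stage f n q.
have thm p : C2F p -> Th p by exists 0.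
have det p q : Th (Imp p q) -> Th p -> Th q.
  move=> [m hm] [n hn]; exists (maxn m n).
  have [_ d] := stage_theory f (maxn m n).
  by apply: d (stage_mono _ hm) (stage_mono _ hn); rewrite (leq_maxl, leq_maxr).
have Thf : ~ Th f by move=> [n]; apply: stage_consistent.
(* Stage [(code p).+1] adds [p] unless stage [code p] already contains [Imp p f]. *)
have max p : ~ Th p -> Th (Imp p f).
  move=> np; apply: contrapT => nimp; apply: np; exists (code p).+1; right.
  exists p; split=> //; first by move=> h; apply: nimp; exists (code p).
  by apply: (proj1 (stage_theory _ _)); apply: C2F_refl.
have valTh : valuation_of_logic (fun p => `[< Th p >]).
  split=> [p /thm /asboolP //|p|p q].
  - rewrite -asbool_neg; apply: asbool_equiv_eq; split=> [hN hp|hp].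
      by apply: Thf; apply: det (det _ _ (thm _ (C2F_explosion p f)) hp) hN.
    apply: contrapT => hN; apply: Thf.
    exact: det (det _ _ (thm _ (C2F_cases p f)) (max _ hp)) (max _ hN).
  - rewrite -asbool_and; apply: asbool_equiv_eq; split=> [h|[hp hq]].
      by split; [apply: det (thm _ (C2F_andEl p q)) h
                |apply: det (thm _ (C2F_andEr p q)) h].
    exact: det (det _ _ (thm _ (C2F_andI p q)) hp) hq.
have /asboolP := all_f (Point (introT (asboolP _) valTh)).
exact: Thf.
Qed.

(** By [lindenbaum], entailment at all points is provability, so the rule of Normality applies. *)
Lemma holds_normality p q r s u :
  (forall v, v p -> v q -> v r) -> u (Cond s p) -> u (Cond s q) -> u (Cond s r).
Proof.
move=> h sp sq.
have pqr : C2F (Imp (And p q) r).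
  apply: lindenbaum => v; rewrite holdsI holdsA.
  by apply/implyP => /andP[vp vq]; apply: h.
have := holds_thm u (C2F_Normality _ _ _ s pqr).
by rewrite holdsI holdsA sp sq.
Qed.

Lemma holds_C2 u p : C2 p -> u p.
Proof. by move=> h; apply/holds_thm/C2F_C2. Qed.

Lemma holds_condW p q u : (forall v, v p -> v q) -> u (Cond p q).
Proof.
move=> h; have up := holds_C2 u (C2_Identity p).
by apply: (holds_normality _ up up) => v /h.
Qed.

Lemma eq_antecedent p q r u :
  (forall v, v p = v q) -> u (Cond p r) = u (Cond q r).
Proof.
have imp p1 p2 : (forall v, v p1 = v p2) -> u (Cond p1 r) -> u (Cond p2 r).
  move=> h ur; have := holds_C2 u (C2_Reciprocity p1 p2 r).
  have p12 : u (Cond p1 p2) by apply: holds_condW => v; rewrite h.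
  have p21 : u (Cond p2 p1) by apply: holds_condW => v; rewrite h.
  by rewrite holdsI !holdsA p12 p21 ur.
by move=> h; apply/idP/idP; apply: imp.
Qed.

(** * Selection of a point by a sentence *)

Definition select p u : option point := insub (fun q => u (Cond p q)).

(** If some [p > q] fails at [u], the consequents of [p] form a point: CEM gives one of [r] and
    [Neg r], and having both would give [q] by Normality. So [select] is [None] only when all
    conditionals from [p] hold. *)
Lemma holds_cond p q u :
  u (Cond p q) = if select p u is Some v then v q else true.
Proof.
rewrite /select; case: insubP => [v _ /= -> //|]; apply: contraNT => npq.
apply/asboolP; split=> [r /holds_thm h|r|r s].
- exact: holds_condW.
- have := holds_C2 u (C2_CEM p r); rewrite holdsO.
  case pr: (u (Cond p r)); case pnr: (u (Cond p (Neg r))) => //= _.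
  case/negP: npq; apply: (holds_normality _ pr pnr) => v.
  by rewrite holdsN => ->.
- apply/idP/andP => [prs|[pr ps]].
    by split; apply: (holds_normality _ prs prs) => v; rewrite holdsA => /andP[].
  by apply: (holds_normality _ pr ps) => v; rewrite holdsA => -> ->.
Qed.

Lemma select_eq p u v : (forall q, u (Cond p q) = v q) -> select p u = Some v.
Proof.
move=> h; rewrite /select; have -> : (fun q => u (Cond p q)) = \val v.
  exact/funext.
exact: valK.
Qed.

Lemma select_holds p u v : select p u = Some v -> v p.
Proof.
by move=> h; have := holds_C2 u (C2_Identity p); rewrite holds_cond h.
Qed.

Lemma select_self p u : u p -> select p u = Some u.
Proof.
move=> up; apply: select_eq => q.
have := holds_C2 u (C2_MP p q); rewrite !holdsI up /=.
have := holds_C2 u (C2_MP p (Neg q)); rewrite !holdsI holdsN up /=.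
have := holds_C2 u (C2_CEM p q); rewrite holdsO.
by case: (u (Cond p q)); case: (u (Cond p (Neg q))); case: (u q).
Qed.

Lemma eq_select p q u : (forall v, v p = v q) -> select p u = select q u.
Proof.
move=> h; rewrite /select; congr insub.
by apply/funext => r; apply: eq_antecedent.
Qed.

(** Since [p] entails [q], [And q p] is equivalent to [p], and Flattening becomes the equivalence of
    [q > (p > r)] and [p > r]. *)
Lemma select_contract p q u :
  (forall v, v p -> v q) -> select p u = obind (select p) (select q u).
Proof.
move=> h.
have qp v : v (And q p) = v p.
  by rewrite holdsA; case vp: (v p); rewrite ?andbF ?andbT // h.
have flat r : u (Cond p r) = u (Cond q (Cond p r)).
  have := holds_thm u (C2F_Flattening q p r).
  rewrite holdsE (eq_antecedent _ _ qp) => /eqP <-; rewrite !holds_cond.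
  by case: (select q u) => // v; apply/esym/eq_antecedent.
have selq := holds_cond q _ u.
case: (select q u) selq => [v|] selq /=.
  by rewrite /select; congr insub; apply/funext => r; rewrite flat selq.
(* With nothing selected by [q], every [p > r] holds at [u], so a point [w] selected by [p] would
   contain every sentence. *)
case e: (select p u) => [w|//].
have wT r : w r by have := flat r; rewrite selq holds_cond e.
by have := wT (Neg p); rewrite holdsN wT.
Qed.

End Points.

(** * Selections over finitely many labels *)

(** All that the combinatorial part needs of points. Labels stand for state descriptions, and
    choosing in [X] for selecting by the disjunction of [X]; the three laws reflect Identity, MP
    with CEM, and Flattening. *)
Record selection (T : finType) := Selection {
  spoint :> Type;
  label : spoint -> T;
  choose_in : {set T} -> spoint -> option spoint;
  choose_inP : forall (X : {set T}) u v, choose_in X u = Some v -> label v \in X;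
  choose_in_self : forall (X : {set T}) u, label u \in X -> choose_in X u = Some u;
  choose_in_contract : forall (X Y : {set T}) u, X \subset Y ->
    choose_in X u = obind (choose_in X) (choose_in Y u)
}.

Section Behaviour.
Variables (T : finType) (S : selection T).
Implicit Types (u v : S) (X Y Z : {set T}) (s t e : T).

(* [None] behaves like a point that sees nothing. *)
Definition behaviour (o : option S) : {ffun {set T} -> option T} :=
  [ffun X => omap (@label _ S) (obind (choose_in X) o)].

Definition first u X : option T := behaviour (Some u) X.

Lemma behaviourE o X : behaviour o X = obind (fun u => first u X) o.
Proof. by rewrite /first !ffunE; case: o => //= u; rewrite ffunE. Qed.

Lemma firstE u X : first u X = omap (@label _ S) (choose_in X u).
Proof. by rewrite /first ffunE /=. Qed.

Lemma first_in u X t : first u X = Some t -> t \in X.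
Proof. by rewrite firstE; case e: choose_in => [v|] //= [<-]; apply: choose_inP e. Qed.

Lemma first_self u X : label u \in X -> first u X = Some (label u).
Proof. by rewrite firstE => /choose_in_self ->. Qed.

Lemma choose_in_sub X Y u v : X \subset Y -> label v \in X ->
  choose_in Y u = Some v -> choose_in X u = Some v.
Proof. by move=> sXY vX e; rewrite (choose_in_contract _ sXY) e /= choose_in_self. Qed.

Lemma first_sub X Y u t : X \subset Y -> t \in X ->
  first u Y = Some t -> first u X = Some t.
Proof.
rewrite !firstE; case e: (choose_in Y u) => [v|] //= sXY tX [vt].
by rewrite (choose_in_sub sXY _ e) /= vt.
Qed.

Lemma first_none X Y u : X \subset Y -> first u Y = None -> first u X = None.
Proof.
rewrite !firstE => sXY; case e: (choose_in Y u) => [v|] //= _.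
by rewrite (choose_in_contract _ sXY) e.
Qed.

(* The descriptions that [u] sees strictly before any description in [Z]. *)
Definition before u Z : {set T} :=
  [set t | (t \notin Z) && (first u (t |: Z) == Some t)].

Lemma beforeP u Z t :
  reflect (t \notin Z /\ first u (t |: Z) = Some t) (t \in before u Z).
Proof. by rewrite inE; apply: (iffP andP) => -[-> /eqP]. Qed.

Lemma before_label u Z : label u \notin Z -> label u \in before u Z.
Proof. by move=> uZ; apply/beforeP; rewrite first_self ?setU11. Qed.

(** If the first label in [X] were in [Z], it would also be first in [t |: Z], where [t] is
    first. *)
Lemma first_before u Z t X : t \in before u Z -> t |: Z \subset X ->
  exists2 s, first u X = Some s & s \notin Z.
Proof.
move=> /beforeP[tZ ft] sX; case e: (first u X) => [s|]; last first.
  by rewrite (first_none sX e) in ft.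
exists s => //; apply/negP => sZ.
have := first_sub sX (setU1r t sZ) e; rewrite ft => -[ts].
by rewrite ts sZ in tZ.
Qed.

(** Compare both sides with the choice in [X :|: Z]: it cannot land outside [Z], for its label would
    then lie in [X] and in [before u Z]. *)
Lemma choose_in_exit u Z X : [disjoint X & before u Z] ->
  choose_in X u = obind (choose_in X) (choose_in Z u).
Proof.
move=> dis; rewrite (choose_in_contract _ (subsetUl X Z)).
rewrite (choose_in_contract _ (subsetUr X Z)).
case e: (choose_in (X :|: Z) u) => [v|] //=.
have [vZ|vZ] := boolP (label v \in Z); first by rewrite (@choose_in_self _ _ Z).
have vX : label v \in X by have := choose_inP e; rewrite inE (negPf vZ) orbF.
case/negP: (disjointFr dis vX); apply/beforeP; split=> //.
apply: (@first_sub _ (X :|: Z)); rewrite ?setU11 ?firstE ?e //.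
by rewrite setSU // sub1set.
Qed.

Lemma before_last u Z : label u \notin Z -> before u Z != [set label u] ->
  exists e, [/\ e \in before u Z, e != label u & before u (e |: Z) = before u Z :\ e].
Proof.
move=> uZ; rewrite eqEsubset sub1set before_label // andbT.
case/subsetPn => t0; rewrite inE => t0b t0u.
have h0 : (t0 \in before u Z) && (t0 != label u) by rewrite t0b.
pose P e := (e \in before u Z) && (e != label u).
(* The last description before [Z] is the one with the most descriptions before it. *)
case: (@arg_maxnP _ t0 P (fun e => #|before u (e |: Z)|) h0) => e /andP[eb eu] emax.
exists e; split=> //.
have [eZ fe] := beforeP _ _ _ eb.
have sub : before u (e |: Z) \subset before u Z :\ e.
  apply/subsetP => s /beforeP[]; rewrite !inE negb_or => /andP[-> sZ] fs /=.
  rewrite sZ; apply/eqP; apply: first_sub fs; rewrite ?setU11 //.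
  by rewrite setUS ?subsetUr.
(* Another [t] not seen before [e] would be seen after it, hence preceded by [e] and by all that
   precedes [e], against maximality. *)
apply/eqP; rewrite eqEsubset sub /=; apply/subsetPn => -[t].
rewrite !inE => /andP[te /andP[tZ /eqP ft]]; rewrite negb_or te tZ /= => nft.
have ft' : first u (t |: (e |: Z)) = Some e.
  have tb : t \in before u Z by apply/beforeP.
  have sX : t |: Z \subset t |: (e |: Z) by rewrite setUS ?subsetUr.
  have [s fs sZ] := first_before tb sX.
  have := first_in fs; rewrite !inE (negPf sZ) orbF => /orP[] /eqP es.
    by rewrite fs es eqxx in nft.
  by rewrite fs es.
have ut : label u != t.
  by apply: contraNneq nft => ut; rewrite -ut first_self ?setU11.
have tC : t |: (e |: Z) = e |: (t |: Z) by rewrite setUCA.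
have esub : e |: before u (e |: Z) \subset before u (t |: Z).
  apply/subsetP => s /setU1P[->|].
    by apply/beforeP; rewrite -tC ft' !inE negb_or eq_sym te.
  case/beforeP; rewrite !inE negb_or => /andP[se sZ] fs.
  have st : s != t.
    by apply: contraNneq nft => <-; apply/eqP.
  rewrite negb_or st sZ /=; apply/eqP.
  (* The first label seen in [W] can only be [s]: [e] comes before [t], and [s] before [e]. *)
  pose W := s |: (t |: (e |: Z)).
  have sb : s \in before u Z.
    apply/beforeP; split=> //; apply: first_sub fs; rewrite ?setU11 //.
    by rewrite setUS ?subsetUr.
  have [|r fr rZ] := @first_before _ _ _ W sb.
    by rewrite setUS // setUA subsetUr.
  have := first_in fr; rewrite !inE (negPf rZ) orbF => /or3P[] /eqP er; subst r.
  - apply: first_sub fr; rewrite ?setU11 //.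
    by rewrite setUS // setUS // subsetUr.
  - have := first_sub (subsetUr _ _) _ fr; rewrite setU11 ft' => /(_ isT) [].
    by move/eqP; rewrite eq_sym (negPf te).
  - have sX : s |: (e |: Z) \subset W by rewrite setUS // subsetUr.
    have := first_sub sX _ fr; rewrite fs !inE eqxx orbT => /(_ isT) [].
    by move/eqP; rewrite (negPf se).
have tb : P t.
  by rewrite /P eq_sym ut andbT; apply/beforeP.
have := leq_trans (subset_leq_card esub) (emax _ tb).
by rewrite cardsU1 !inE eqxx ltnn.
Qed.

(** This allows the word to go on from the [e]-point: the target in [Z] is unchanged and the
    induction measure cannot grow. *)
Lemma before_exit u Z e u' : e \in before u Z ->
  choose_in (e |: Z) u = Some u' ->
  [/\ label u' = e, choose_in Z u' = choose_in Z u & before u' Z \subset before u Z].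
Proof.
move=> eb eu'; have [eZ fe] := beforeP _ _ _ eb.
have lu' : label u' = e by move: fe; rewrite firstE eu' => -[].
split=> //; first by rewrite (choose_in_contract u (subsetUr [set e] Z)) eu'.
apply/subsetP => t /beforeP[tZ ft]; apply/beforeP; split=> //.
have sX : e |: Z \subset t |: (e |: Z) by rewrite subsetUr.
have sY : t |: Z \subset t |: (e |: Z) by rewrite setUS ?subsetUr.
(* Either [u] meets [t] before [e], or it meets [e] first, at the point [u'], and its choice in
   [t |: Z] is that of [u']. *)
have [s fs sZ] := first_before eb sX.
have := first_in fs; rewrite !inE (negPf sZ) orbF => /orP[] /eqP es; subst s.
  by apply: first_sub sY _ fs; rewrite setU11.
move: fs; rewrite firstE; case ev: choose_in => [v|] //= [lv].
have := choose_in_sub sX _ ev; rewrite lv setU11 eu' => /(_ isT) [uv].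
by rewrite firstE (choose_in_contract _ sY) ev /= -uv -firstE.
Qed.

End Behaviour.

(** * Blocks: finite flat orders built by concatenation and repetition *)

(* [sees w] is ordered by [rank w]; values of [rank w] elsewhere are irrelevant. *)
Record block := Block {
  position :> finType;
  start : position;
  sees : rel position;
  rank : position -> position -> nat;
  width : nat;
  sees_refl : reflexive sees;
  sees_trans : transitive sees;
  sees_start : forall x, sees start x;
  rank_self : forall w, rank w w = 0;
  rank_inj : forall w x y, sees w x -> sees w y -> rank w x = rank w y -> x = y;
  rank_width : forall w x, rank w x < width;
  sees_later : forall w x y, sees w x -> sees w y -> rank w x < rank w y -> sees x y;
  rank_later : forall w x y z, sees w x -> sees w y -> sees w z ->
    rank w x < rank w y -> rank w y < rank w z -> rank x y < rank x z
}.

Definition single_block : block.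
Proof.
refine (@Block unit tt (fun _ _ => true) (fun _ _ => 0) 1 _ _ _ _ _ _ _ _) => //.
by move=> [] [] [].
Defined.

Section SeqBlock.
Variables P Q : block.

Definition seq_sees (x y : P + Q) : bool :=
  match x, y with
  | inl a, inl b => sees a b
  | inl _, inr _ => true
  | inr _, inl _ => false
  | inr a, inr b => sees a b
  end.

Definition seq_rank (x y : P + Q) : nat :=
  match x, y with
  | inl a, inl b => rank a b
  | inl _, inr b => width P + rank (start Q) b
  | inr _, inl _ => 0
  | inr a, inr b => rank a b
  end.

Lemma leq_rank_width (w x : P) n : rank w x < width P + n.
Proof. exact: leq_trans (rank_width _ _) (leq_addr _ _). Qed.

Definition seq_block : block.
Proof.
refine (@Block (P + Q)%type (inl (start P)) seq_sees seq_rank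
  (width P + width Q) _ _ _ _ _ _ _ _).
- by move=> [a|b] /=; rewrite sees_refl.
- by move=> [b|b] [a|a] [c|c] //=; apply: sees_trans.
- by move=> [a|b] //=; apply: sees_start.
- by move=> [a|b] /=; apply: rank_self.
- move=> [w|w] [x|x] [y|y] //=.
  + by move=> wx wy /(rank_inj wx wy) ->.
  + by move=> _ _ e; have := leq_rank_width w x (rank (start Q) y); rewrite e ltnn.
  + by move=> _ _ e; have := leq_rank_width w y (rank (start Q) x); rewrite e ltnn.
  + by move=> _ _ /addnI/rank_inj ->; rewrite ?sees_start.
  + by move=> wx wy /(rank_inj wx wy) ->.
- move=> [w|w] [x|x] /=; rewrite ?leq_rank_width ?ltn_add2l ?rank_width //.
  + by rewrite addn_gt0 (leq_ltn_trans _ (rank_width w w)) ?orbT.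
  + exact: leq_trans (rank_width w x) (leq_addl _ _).
- move=> [w|w] [x|x] [y|y] //=.
  + exact: sees_later.
  + by move=> _ _; rewrite ltnNge (ltnW (leq_rank_width _ _ _)).
  + by move=> _ _; rewrite ltn_add2l; apply: sees_later; rewrite sees_start.
  + exact: sees_later.
- move=> [w|w] [x|x] [y|y] [z|z] //=; rewrite ?leq_rank_width ?ltn_add2l //.
  + exact: rank_later.
  + by move=> _ _ _ _; rewrite ltnNge (ltnW (leq_rank_width _ _ _)).
  + by move=> _ _ _; rewrite ltnNge (ltnW (leq_rank_width _ _ _)).
  + by move=> _ _ _; rewrite ltnNge (ltnW (leq_rank_width _ _ _)).
  + by move=> _ _ _ _; rewrite ltnNge (ltnW (leq_rank_width _ _ _)).
  + by move=> _ _ _; apply: rank_later; rewrite sees_start.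
  + exact: rank_later.
Defined.

End SeqBlock.

Section LoopBlock.
Variable P : block.

(** First occurrences in the repeated word: what [w] still sees in its own round comes first, and
    everything else waits for the next round, read from [start P]. *)
Definition loop_rank (w x : P) : nat :=
  if sees w x then rank w x else width P + rank (start P) x.

Lemma loop_rank_lt (w x y : P) : (loop_rank w x < loop_rank w y) =
  if sees w x then sees w y ==> (rank w x < rank w y)
  else ~~ sees w y && (rank (start P) x < rank (start P) y).
Proof.
rewrite /loop_rank; case: (sees w x); case: (sees w y) => //=.
- exact: leq_rank_width.
- by rewrite ltnNge (ltnW (leq_rank_width _ _ _)).
- by rewrite ltn_add2l.
Qed.

Definition loop_block : block.
Proof.
refine (@Block P (start P) (fun _ _ => true) loop_rank (width P + width P)
  _ _ _ _ _ _ _ _) => //.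
- by move=> w; rewrite /loop_rank sees_refl rank_self.
- move=> w x y _ _; rewrite /loop_rank; case: ifP => wx; case: ifP => wy.
  + exact: rank_inj.
  + by move=> e; have := leq_rank_width w x (rank (start P) y); rewrite e ltnn.
  + by move=> e; have := leq_rank_width w y (rank (start P) x); rewrite e ltnn.
  + by move/addnI/rank_inj; apply; rewrite sees_start.
- move=> w x; rewrite /loop_rank; case: ifP => _; last by rewrite ltn_add2l rank_width.
  exact: leq_rank_width.
- move=> w x y z _ _ _; rewrite !loop_rank_lt.
  (* What [w] has missed in this round is also missed by the later [x]. *)
  have nsees a : sees w x -> sees w a = false -> sees x a = false.
    by move=> wx wa; apply: contraFF wa => /(sees_trans wx).
  case wx: (sees w x); case wy: (sees w y); case wz: (sees w z) => //=.
  + move=> xy yz; have xz := ltn_trans xy yz.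
    by rewrite !(sees_later _ _ xy, sees_later _ _ xz) //; apply: rank_later yz.
  + by move=> xy _; rewrite (sees_later _ _ xy) // nsees.
  + by move=> _ yz; rewrite !nsees.
  (* All three are met only in the next round, where [start P] ranks them. *)
  + move=> xy yz; have xz := ltn_trans xy yz.
    rewrite (sees_later _ _ xy) ?sees_start // (sees_later _ _ xz) ?sees_start //=.
    by apply: rank_later xy yz; rewrite sees_start.
Defined.

End LoopBlock.

(** * Words of points *)

Section Segments.
Variables (T : finType) (S : selection T).
Implicit Types (u v : S) (X Z B : {set T}) (t : T).
Implicit Types sigma tau rho : {ffun {set T} -> option T}.

Definition first_visit (P : block) (pt : P -> S) (w : P) X (y : P) : Prop :=
  [/\ sees w y, label (pt y) \in X &
      forall z, sees w z -> label (pt z) \in X -> rank w y <= rank w z].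

(* Inside [P] every position behaves like its point as long as possible, and
   like [rho] on sets that no position it sees in [P] meets. *)
Definition segment (P : block) (pt : P -> S) sigma rho :=
  behaviour (Some (pt (start P))) = sigma /\
  forall w X,
    (exists2 y, first_visit pt w X y & first (pt w) X = Some (label (pt y))) \/
    ((forall z, sees w z -> label (pt z) \notin X) /\ first (pt w) X = rho X).

Definition connected sigma rho : Prop :=
  exists (P : block) (pt : P -> S), segment pt sigma rho.

Definition seq_point (P Q : block) (pt : P -> S) (qt : Q -> S) (x : seq_block P Q) : S :=
  match x with inl a => pt a | inr b => qt b end.

(** A position that meets no [X]-label within [P] behaves on [X] like [tau], which is the behaviour
    at the start of [Q]. *)
Lemma segment_seq (P Q : block) (pt : P -> S) (qt : Q -> S) sigma tau rho :
  segment pt sigma tau -> segment qt tau rho ->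
  segment (seq_point pt qt) sigma rho.
Proof.
move=> [sP hP] [sQ hQ]; split=> // -[a|b] X.
- have [[y [ay yX ymin] fy]|[aX ->]] := hP a X.
    left; exists (inl y) => //; split=> // -[z|z] /=; first exact: ymin.
    by move=> _ _; apply: ltnW (leq_rank_width _ _ _).
  rewrite -sQ -/(first _ _).
  have [[y [ay yX ymin] ->]|[bX ->]] := hQ (start Q) X.
    left; exists (inr y) => //; split=> // -[z|z] /= az zX.
      by case/negP: (aX z az).
    by rewrite leq_add2l; apply: ymin; rewrite ?sees_start.
  right; split=> // -[z|z] /=; first exact: aX.
  by move=> _; apply: bX; apply: sees_start.
- have [[y [ay yX ymin] fy]|[bX ->]] := hQ b X.
    by left; exists (inr y) => //; split=> // -[z|z] //=; apply: ymin.
  by right; split=> // -[z|z] //=; apply: bX.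
Qed.

(** A position that meets no [X]-label in the rest of its round behaves on [X] like [sigma], that
    is, like the start of the next round. Only sets met nowhere in [P] are left to [rho]. *)
Lemma segment_loop (P : block) (pt : P -> S) sigma rho :
  segment pt sigma sigma ->
  (forall X, (forall z, label (pt z) \notin X) -> sigma X = rho X) ->
  @segment (loop_block P) pt sigma rho.
Proof.
move=> [sP hP] hX; split=> // w X.
have [[y [wy yX ymin] fy]|[wX ->]] := hP w X.
  left; exists y => //; split=> // z _ zX; rewrite leqNgt loop_rank_lt wy.
  by case: ifP => // wz /=; apply/negP => lt; have := ymin z wz zX; rewrite leqNgt lt.
have nsees z : label (pt z) \in X -> @sees P w z = false.
  by move=> zX; apply/negP =>  /wX; rewrite zX.
have [[y [wy yX ymin] fy]|[bX fr]] := hP (start P) X.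
  left; exists y; last by rewrite -sP.
  split=> // z _ zX; rewrite leqNgt loop_rank_lt !nsees //= -leqNgt.
  by apply: ymin; rewrite ?sees_start.
have nX z : label (pt z) \notin X by apply/bX/sees_start.
by right; split=> //; apply: hX.
Qed.

Lemma connected_seq sigma tau rho :
  connected sigma tau -> connected tau rho -> connected sigma rho.
Proof.
move=> [P [pt hP]] [Q [qt hQ]]; exists (seq_block P Q), (seq_point pt qt).
exact: segment_seq hP hQ.
Qed.

(** * Leading a word from a point to its first [Z]-point *)

Lemma behaviour_label u v :
  behaviour (Some u) = behaviour (Some v) -> label u = label v.
Proof.
move=> e; have : first u setT = first v setT by rewrite /first e.
by rewrite !first_self ?inE // => -[].
Qed.

(* A word from [sigma] to [u] that can be closed up into a loop: [label u] will
   occur at the start of the loop when [sigma] is the behaviour of [u]. *)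
Definition loops_to B sigma u : Prop :=
  exists (P : block) (pt : P -> S), segment pt sigma (behaviour (Some u)) /\
    forall t, t \in B -> t = label u \/ exists y, label (pt y) = t.

(** A set missed by the whole loop is disjoint from [before u Z], so by [choose_in_exit] the choice
    of [u] in it passes through the first [Z]-point. *)
Lemma loops_to_closed Z u : label u \notin Z ->
  loops_to (before u Z) (behaviour (Some u)) u ->
  connected (behaviour (Some u)) (behaviour (choose_in Z u)).
Proof.
move=> uZ [P [pt [hP cov]]]; exists (loop_block P), pt.
have [sP _] := hP.
apply: segment_loop hP _ => X nX.
rewrite ffunE [RHS]ffunE /= (@choose_in_exit _ _ _ Z) // disjoint_subset.
apply/subsetP => t tX; apply/negP => /cov tP.
have [y yt] : exists y, label (pt y) = t.
  by case: tP => // ->; exists (start P); apply: behaviour_label.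
by have := nX y; rewrite yt tX.
Qed.

(** If [t] did not occur in the word, its start would behave on [t |: (e |: Z)] like [u'] and find
    [e] first, or find another label of the word; but [u] finds [t] first. *)
Lemma segment_covers (P : block) (pt : P -> S) Z u e u' t :
  segment pt (behaviour (Some u)) (behaviour (Some u')) ->
  label u' = e -> t \in before u (e |: Z) -> exists y, label (pt y) = t.
Proof.
move=> [sP hP] u'e /beforeP[te ft].
have [[y _]|[_]] := hP (start P) (t |: (e |: Z)); rewrite /first sP -/(first _ _) ft.
  by case=> ->; exists y.
rewrite -/(first _ _) first_self ?u'e => [[et]|]; last by rewrite !inE eqxx orbT.
by rewrite et setU11 in te.
Qed.

Lemma connected_singleton Z u : before u Z = [set label u] ->
  connected (behaviour (Some u)) (behaviour (choose_in Z u)).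
Proof.
move=> b1; exists single_block, (fun=> u); split=> // -[] X.
have [uX|uX] := boolP (label u \in X).
  by left; exists tt => //; rewrite first_self.
right; split=> //; rewrite /first ffunE [RHS]ffunE /= (@choose_in_exit _ _ _ Z) //.
by rewrite b1 disjoint_sym disjoints1.
Qed.

(* [V] collects the behaviours already met since the induction on [B] started. *)
Lemma connected_step Z B (z : option S) m (V : {set {ffun {set T} -> option T}}) u :
  (forall Z' v, label v \notin Z' -> #|before v Z'| < #|B| ->
     connected (behaviour (Some v)) (behaviour (choose_in Z' v))) ->
  #|~: V| <= m -> label u \notin Z -> before u Z = B -> choose_in Z u = z ->
  (forall sigma, sigma \in V -> loops_to B sigma u) ->
  connected (behaviour (Some u)) (behaviour z).
Proof.
move=> IH; elim: m V u => [|m IHm] V u cardV uZ uB uz hV.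
  (* Every behaviour is already in [V], so this one recurs. *)
  have uV : behaviour (Some u) \in V.
    move: cardV; rewrite leqn0 cards_eq0 => /eqP/setP/(_ (behaviour (Some u))).
    by rewrite in_setC in_set0 => /negbFE.
  by rewrite -uz; apply: loops_to_closed; rewrite ?uB //; apply: hV.
have [uV|uV] := boolP (behaviour (Some u) \in V).
  by rewrite -uz; apply: loops_to_closed; rewrite ?uB //; apply: hV.
have [b1|b1] := eqVneq (before u Z) [set label u].
  by rewrite -uz; apply: connected_singleton.
have [e [eb eu be]] := before_last uZ b1.
have [eZ fe] := beforeP _ _ _ eb.
case eu': (choose_in (e |: Z) u) => [u'|]; last by rewrite firstE eu' in fe.
have [u'e u'z u'b] := before_exit eb eu'.
have u'Z : label u' \notin Z by rewrite u'e.
have [P [pt hP]] : connected (behaviour (Some u)) (behaviour (Some u')).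
  rewrite -eu'; apply: IH; first by rewrite !inE eq_sym negb_or eu.
  by rewrite be -uB [X in _ < X](cardsD1 e) eb.
apply: (@connected_seq _ (behaviour (Some u'))); first by exists P, pt.
(* If fewer descriptions remain before [Z], the induction on their number finishes from [u']. *)
have [bB|bB] := eqVneq (before u' Z) B; last first.
  rewrite -uz -u'z; apply: IH => //; rewrite -uB in bB *.
  by apply: proper_card; rewrite properEneq bB.
have coverP t : t \in B -> t = label u' \/ exists y, label (pt y) = t.
  rewrite -uB => tb; have [->|te] := eqVneq t e; first by left.
  by right; apply: (segment_covers hP u'e (Z := Z)); rewrite be in_setD1 te.
(* Otherwise the behaviour of [u] joins [V], and the words recorded for [V] are prolonged by the one
   from [u] to [u']. *)
apply: (IHm (behaviour (Some u) |: V)); rewrite ?u'z //.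
  rewrite -ltnS (leq_trans _ cardV) // proper_card // properE !setCS.
  by rewrite subsetUr subUset sub1set (negPf uV).
move=> sigma /setU1P[->|/hV[Q [qt [hQ _]]]]; first by exists P, pt.
exists (seq_block Q P), (seq_point qt pt); split; first exact: segment_seq hQ hP.
move=> t /[dup] tB /coverP[->|[y <-]]; first by left.
by right; exists (inr y).
Qed.

Lemma connected_before Z u : label u \notin Z ->
  connected (behaviour (Some u)) (behaviour (choose_in Z u)).
Proof.
have [n] := ubnP #|before u Z|; elim: n Z u => // n IHn Z u cardb uZ.
(* No behaviour has been met yet, and [m] bounds the finite number of all behaviours. *)
apply: (@connected_step Z (before u Z) _ #|~: set0| set0) => //.
  by move=> Z' v vZ' cardv; apply: IHn => //; apply: leq_trans cardv _.
by move=> sigma; rewrite inE.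
Qed.

(** No label lies in the empty set, so a word leading to the first [set0]-point ends in [None]. *)
Lemma connected_none u : connected (behaviour (Some u)) (behaviour (None : option S)).
Proof.
have := @connected_before set0 u; rewrite inE => /(_ isT).
by case e: choose_in => [v|] //; have := choose_inP e; rewrite inE.
Qed.

End Segments.

(** * Blocks as finite flat order frames *)

Definition block_prec (P : block) (w x y : P) : Prop :=
  [/\ sees w x, sees w y & rank w x < rank w y].

Lemma rank_gt0 (P : block) (w x : P) : sees w x -> w <> x -> 0 < rank w x.
Proof.
move=> wx nwx; rewrite lt0n; apply/eqP => r0; apply: nwx.
by apply: (rank_inj (sees_refl w) wx); rewrite rank_self.
Qed.

Lemma block_prec_well_order (P : block) (w : P) :
  exists A : P -> Prop, strict_well_order_on A (block_prec w).
Proof.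
exists (fun x => sees w x); split=> [x y []//||x y wx wy|Q QA [x0 Qx0]].
- split=> [x [_ _]|x y z [wx _ xy] [_ wz yz]]; first by rewrite ltnn.
  by split=> //; apply: ltn_trans yz.
- have [lt|lt|/(rank_inj wx wy) ->] := ltngtP (rank w x) (rank w y).
  + by left.
  + by right; right.
  + by right; left.
- have /asboolP h0 := Qx0.
  case: (@arg_minnP _ x0 (fun x => `[< Q x >]) (rank w) h0) => m /asboolP Qm mmin.
  exists m; split=> // x Qx; have mx := mmin x (introT (asboolP _) Qx).
  have [wx wm] := (QA x Qx, QA m Qm).
  move: mx; rewrite leq_eqVlt => /orP[/eqP/(rank_inj wm wx)|mx]; first by left.
  by right.
Qed.

Lemma block_prec_centered (P : block) (w x y : P) :
  block_prec w x y -> w = x \/ block_prec w w x.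
Proof.
move=> [wx _ _]; have [->|/eqP nwx] := eqVneq w x; [by left|right].
by split; rewrite ?sees_refl // rank_self rank_gt0.
Qed.

Definition block_frame (P : block) : order_frame :=
  @Build_order_frame P (inhabits (start P)) (@block_prec P)
    (@block_prec_well_order P) (@block_prec_centered P).

Lemma accessP (P : block) (w x : P) : @access (block_frame P) w x <-> sees w x.
Proof.
split=> [[->|[]//]|wx]; first exact: sees_refl.
have [->|/eqP nwx] := eqVneq w x; [by left|right].
by split; rewrite ?sees_refl // rank_self rank_gt0.
Qed.

Lemma block_frame_finite (P : block) : finite_frame (block_frame P).
Proof.
exists (enum P) => x; have : x \in enum P by rewrite mem_enum.
by elim: (enum P) => //= y s IH; rewrite inE => /orP[/eqP ->|/IH]; [left|right].
Qed.

(** Transitivity makes the case of [z] accessible from [x] but not from [w] vacuous; the other case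
    is [rank_later]. *)
Lemma block_frame_flat (P : block) : flat (block_frame P).
Proof.
split=> [w x y [wx wy xy]|w x y]; last first.
  by rewrite !accessP; apply: sees_trans.
have xy' := sees_later wx wy xy; split=> [|z]; first exact/accessP.
case=> [[_ wz yz]|[]]; last by rewrite !accessP => /(sees_trans wx).
have xz := sees_later wx wz (ltn_trans xy yz).
by split=> //; apply: rank_later yz.
Qed.

(** * State descriptions over a finite list of sentences *)

Fixpoint subformulas p : seq sentence :=
  p :: match p with
       | Atom _ => [::]
       | Neg q => subformulas q
       | And q r | Cond q r => subformulas q ++ subformulas r
       end.

HB.instance Definition _ := Equality.copy sentence (inj_type code_inj).

(** The language has no constant for truth; Identity provides one. *)
Definition verum : sentence := Cond (Atom 0) (Atom 0).

Fixpoint description (s : seq sentence) (t : seq bool) : sentence :=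
  match s, t with
  | p :: s', b :: t' => And (if b then p else Neg p) (description s' t')
  | _, _ => verum
  end.

Lemma holds_verum (u : point) : u verum.
Proof. exact: holds_C2 (C2_Identity _). Qed.

Lemma holds_description (u : point) s t : size t = size s ->
  u (description s t) = (map u s == t).
Proof.
elim: s t => [|p s IHs] [|b t] //= => [_|[/IHs IH]]; first exact: holds_verum.
by rewrite holdsA IH eqseq_cons; case: b; rewrite ?holdsN; case: (u p).
Qed.

Section Descriptions.
Variable s : seq sentence.
Implicit Types (u v : point) (X Y : {set (size s).-tuple bool}).

Definition description_of u : (size s).-tuple bool := map_tuple u (in_tuple s).

Definition disjunction X : sentence :=
  foldr (fun t : (size s).-tuple bool => Or (description s t)) (Neg verum) (enum X).

Lemma holds_disjunction u X : u (disjunction X) = (description_of u \in X).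
Proof.
rewrite -mem_enum /disjunction; elim: (enum X) => [|t l IH] /=.
  by rewrite holdsN holds_verum.
by rewrite holdsO IH inE holds_description ?size_tuple.
Qed.

Lemma disjunction_select_in X u v :
  select (disjunction X) u = Some v -> description_of v \in X.
Proof. by move/select_holds; rewrite holds_disjunction. Qed.

Lemma disjunction_select_self X u :
  description_of u \in X -> select (disjunction X) u = Some u.
Proof. by rewrite -holds_disjunction; apply: select_self. Qed.

Lemma disjunction_select_contract X Y u : X \subset Y ->
  select (disjunction X) u =
  obind (select (disjunction X)) (select (disjunction Y) u).
Proof.
move=> /subsetP sXY; apply: select_contract => v.
by rewrite !holds_disjunction; apply: sXY.
Qed.

Definition point_selection : selection ((size s).-tuple bool : finType) :=
  Selection disjunction_select_in disjunction_select_self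
    disjunction_select_contract.

Definition truth_set p : {set (size s).-tuple bool} :=
  [set t : (size s).-tuple bool | nth false t (index p s)].

Lemma in_truth_set p u : p \in s -> (description_of u \in truth_set p) = u p.
Proof.
by move=> ps; rewrite inE /= (nth_map p) ?index_mem // nth_index.
Qed.

(** At every point, [p] has the truth value of the disjunction of the descriptions that affirm it,
    so both select the same point. *)
Lemma holds_cond_first p q u : p \in s -> q \in s ->
  u (Cond p q) = if @first _ point_selection u (truth_set p) is Some t
                 then t \in truth_set q else true.
Proof.
move=> ps qs; rewrite holds_cond firstE /=.
have -> : select p u = select (disjunction (truth_set p)) u.
  by apply: eq_select => v; rewrite holds_disjunction in_truth_set.
by case: (select _ u) => //= v; rewrite in_truth_set.
Qed.

End Descriptions.

(** * Truth lemma and completeness *)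

Definition block_model (P : block) (pt : P -> point) : order_model :=
  @Build_order_model (block_frame P) (fun k w => pt w (Atom k)).

Lemma block_model_truth (s : seq sentence) (P : block)
    (pt : P -> point_selection s) sigma p (w : P) :
  segment pt sigma (behaviour (None : option (point_selection s))) ->
  {subset subformulas p <= s} ->
  true_at (block_model pt) p w <-> holds (pt w) p.
Proof.
move=> [_ hP]; elim: p w => [k|p IHp|p IHp q IHq|p IHp q IHq] w /= sub //.
- have subp : {subset subformulas p <= s} by move=> x xp; apply: sub; rewrite inE xp orbT.
  by rewrite IHp // holdsN; split=> /negP.
- have subp : {subset subformulas p <= s}.
    by move=> x xp; apply: sub; rewrite inE mem_cat xp orbT.
  have subq : {subset subformulas q <= s}.
    by move=> x xq; apply: sub; rewrite inE mem_cat xq !orbT.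
  by rewrite IHp // IHq // holdsA; split=> /andP.
- have subp : {subset subformulas p <= s}.
    by move=> x xp; apply: sub; rewrite inE mem_cat xp orbT.
  have subq : {subset subformulas q <= s}.
    by move=> x xq; apply: sub; rewrite inE mem_cat xq !orbT.
  have ps : p \in s by apply: subp; case: (p) => *; apply: mem_head.
  have qs : q \in s by apply: subq; case: (q) => *; apply: mem_head.
  have lp (y : P) : (label (pt y) \in truth_set s p) = holds (pt y) p.
    exact: in_truth_set.
  rewrite (holds_cond_first _ ps qs).
  (* As the word ends in [None], a position that sees no [p]-label has a point that selects nothing
     by [p], and the conditional is vacuous on both sides. *)
  have [[y [wy yp ymin] fy]|[wp fw]] := hP w (truth_set s p); last first.
    rewrite fw behaviourE /=; split=> // _; left => y /accessP wy.
    by rewrite (IHp y subp) -lp; apply/negP/wp.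
  rewrite fy in_truth_set //; split.
    case=> [/(_ y)|[x [/accessP wx [px [qx xmin]]]]].
      by rewrite accessP IHp // -lp => /(_ wy).
    have xp : label (pt x) \in truth_set s p by rewrite lp; apply/(IHp x subp).
    have yx : ~~ (rank w y < rank w x).
      apply/negP => lt; apply: (xmin y); first by split.
      by apply/(IHp y subp); rewrite -lp.
    have e : rank w y = rank w x.
      by apply/eqP; rewrite eqn_leq (ymin x wx xp) leqNgt yx.
    by rewrite (rank_inj wy wx e); apply/(IHq x subq).
  move=> yq; right; exists y; split; first exact/accessP.
  split; first by apply/(IHp y subp); rewrite -lp.
  split=> [|x [wx _ xy]]; first exact/(IHq y subq).
  by rewrite (IHp x subp) -lp => /(ymin x wx); rewrite leqNgt xy.
Qed.

Unset Implicit Arguments.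

Theorem theorem4p4 (p : sentence) :
  (forall M : order_model,
     finite_frame (frame M) -> flat (frame M) -> forall w : M, true_at M p w) ->
  C2F p.
Proof.
move=> valid; apply: lindenbaum => u.
have [P [pt seg]] := @connected_none _ (point_selection (subformulas p)) u.
have [startE _] := seg.
have ps : p \in subformulas p by case: (p) => *; apply: mem_head.
have labelE : description_of (subformulas p) (pt (start P)) = description_of _ u.
  exact: behaviour_label startE.
(* The start of the block has the same description as [u], hence agrees with [u] on [p]. *)
rewrite -(in_truth_set u ps) -labelE in_truth_set //.
apply/(block_model_truth _ seg) => //.
exact: (valid (block_model pt) (block_frame_finite P) (block_frame_flat P)).
Qed.
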